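(* The sharding protocol Elastico does not satisfy scalability in the system model described in the context.
   Context: Model. A protocol is run by $n$ parties in synchronous rounds: all messages are delivered by the end of each round. An epoch is a set of $R$ consecutive rounds. The adversary is computationally bounded and slowly-adaptive: it may choose the corrupted parties anew at the beginning of each epoch but cannot change them during an epoch; at every round at most $f$ parties are corrupted. Transactions spend unspent transaction outputs (UTXOs) and create new ones. There are $m$ shards; a shard's chain contains a ledger $\langle x_1,\dots,x_l\rangle$ with $x_j$ the transactions of the $j$-th block. A block contains at most a constant number of transactions (so storing or downloading the headers/hash-chain of a ledger is asymptotically equivalent to storing or downloading its transactions). The input transaction set $T$ consists of valid transactions given to all parties long enough to be included. Scalability: $\omega_m=o(n)$, $\omega_s=o(1)$ and $\omega_c=o(n)$. Here the communication factor $\omega_m$ is the communication complexity of the system per transaction divided by $n$ (average data sent or received per party to include a transaction; the worst over all subroutines, both within an epoch and at epoch transitions, the latter amortized over the epoch length); the space factor is $\omega_s=\sum_{j\in[n]}\sum_{L\in SL_j}|L^{\lceil k}|/(n|T|)$, with $SL_j$ the collection of ledgers kept by party $j$ and $|L^{\lceil k}|$ the number of transactions in $L$ after removing the last $k$ blocks; the computational factor is $\omega_c=\sum_{i\in[n]}q_i/|T|$, with $q_i$ the number of transaction-verification (oracle) calls made by party $i$. Elastico (permissionless; adversary controls $f<n/4$ identities). In each epoch participants create valid identities by proof-of-work using the previous epoch's randomness; identities are assigned at random to $m=2^s$ shards (committees) of constant size $c$, $n=c\cdot 2^s$. A transaction is assigned to a shard according to the hash of its inputs; each shard validates its transactions by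 running a BFT consensus protocol among its members and sends them to the final committee. At the end of every epoch, which corresponds to the generation of one block per shard, the final committee computes (by BFT) and broadcasts to the entire network the final block, containing the Merkle roots of all shards' blocks. All parties download and store every final block. The final committee also generates the randomness for the next epoch by a commit-and-XOR protocol. *)

(* Defs.v *)
From Stdlib Require List.
From HB Require Import structures.
From mathcomp Require Import all_boot all_order all_algebra.
From mathcomp Require Import all_classical all_reals all_analysis.
Set Implicit Arguments.
Unset Strict Implicit.
Unset Printing Implicit Defensive.
Import Order.TTheory GRing.Theory Num.Theory.
Import numFieldNormedType.Exports.
Local Open Scope ring_scope.

Definition utxo := nat.

(* A transaction is the pair (outputs it spends, outputs it creates).  Amounts
   and signatures play no role. *)
Definition tx := (seq utxo * seq utxo)%type.
Definition ins (t : tx) : seq utxo := t.1.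
Definition outs (t : tx) : seq utxo := t.2.

Section Validity.
Variable genesis : seq utxo.
Implicit Type L : tx -> Prop. (* the transactions of a ledger *)

Definition created L (u : utxo) : Prop :=
  u \in genesis \/ exists2 t, L t & u \in outs t.

Definition spent L (u : utxo) : Prop := exists2 t, L t & u \in ins t.

Definition valid_tx L (t : tx) : Prop :=
  [/\ ins t <> [::], uniq (ins t), uniq (outs t),
      forall u, u \in ins t -> created L u /\ ~ spent L u &
      forall u, u \in outs t -> ~ created L u].

Fixpoint valid_seq L (ts : seq tx) : Prop :=
  if ts is t :: ts' then
    valid_tx L t /\ valid_seq (fun t' => L t' \/ t' = t) ts'
  else True.
End Validity.

(* [B] is the constant bounding the number of transactions in a block. *)
Definition block (B : nat) := B.-bseq tx.

Definition digest := nat.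

(* [lam]-bit strings; exclusive or is the addition of this group. *)
Definition bits (lam : nat) := 'rV['F_2]_lam.

(* Idealized cryptography: Merkle roots and commitments are binding. *)
Record oracles (B lam : nat) := Oracles {
  merkle : block B -> digest;
  merkle_inj : injective merkle;
  commitment : bits lam -> digest;
  commitment_inj : injective commitment;
  hash_ins : seq utxo -> digest;
  (* proof-of-work hash of (epoch randomness, identity key, nonce) *)
  hash_pow : bits lam -> nat -> nat -> digest
}.

(* Party [p] holds one identity in every epoch, so [n = c * 2 ^ s] counts
   both parties and identities. *)
Notation party c s := 'I_(c * 2 ^ s).
Notation shard s := 'I_(2 ^ s).

Definition final_block (s : nat) := {ffun shard s -> digest}.

Inductive payload (B lam s : nat) :=
  | Identity of nat                    (* a proof-of-work nonce *)
  | ShardBft of shard s & nat          (* [ShardBft i d]: [d] units of data *)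
  | ShardBlock of shard s & block B    (* outcome, for the final committee *)
  | FinalBft of nat
  | Final of final_block s
  | Commit of digest
  | Reveal of bits lam
  | Sync of seq (final_block s).       (* past final blocks, for late joiners *)
Arguments Identity {B lam s}.
Arguments ShardBft {B lam s}.
Arguments ShardBlock {B lam s}.
Arguments FinalBft {B lam s}.
Arguments Final {B lam s}.
Arguments Commit {B lam s}.
Arguments Reveal {B lam s}.
Arguments Sync {B lam s}.

(* A stored ledger lists, block after block, either the block itself ([inl])
   or only its header ([inr]). *)
Definition stored_ledger (B : nat) := seq (block B + digest).

(* What happens in one execution, including the choices of the adversary and
   the outcomes of all random choices.  Epochs are numbered from 0, and the
   rounds of each epoch from 0. *)
Record execution (B c s : nat) := Execution {
  epochs : nat;
  rounds : nat;                              (* per epoch *)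
  lam : nat;
  oracle : oracles B lam;
  difficulty : nat;
  genesis : seq utxo;
  input : seq tx;                            (* the set T, in a valid order *)
  corrupt : nat -> {set party c s};          (* constant within an epoch *)
  seed : nat -> bits lam;       (* randomness used to form the committees *)
  nonce : nat -> party c s -> nat;
  committee : nat -> party c s -> shard s;
  final : nat -> shard s;                    (* the final committee *)
  decided : nat -> shard s -> block B;
  contribution : nat -> party c s -> bits lam;
  opened : nat -> {set party c s};           (* parties whose commitment counts *)
  chain : nat -> party c s -> seq (final_block s);   (* when the epoch begins *)
  sent : nat -> nat -> party c s -> party c s -> seq (payload B lam s);
  verified : nat -> party c s -> seq tx;     (* verification-oracle calls *)
  (* the stored ledgers, each labelled with its shard, after the last epoch *)
  kept : party c s -> seq (shard s * stored_ledger B)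
}.

Section Elastico.
Variables (B c s : nat) (X : execution B c s).
Implicit Types (e r : nat) (p q : party c s) (i : shard s).
Local Notation E := (epochs X).
Local Notation R := (rounds X).
Local Notation O := (oracle X).

Definition members e i : {set party c s} :=
  [set p | committee X e p == i].

Definition honest e p : bool := p \notin corrupt X e.

(* The committees on which a BFT protocol is guaranteed to work. *)
Definition secure e i : bool :=
  (3 * #|members e i :&: corrupt X e| < c)%N.

Definition in_chain (ch : seq (final_block s)) (t : tx) : Prop :=
  exists fb i b, [/\ fb \in ch, fb i = merkle O b & t \in b].

Definition the_final_block e : final_block s :=
  [ffun i => merkle O (decided X e i)].

Definition headers (ch : seq (final_block s)) i : stored_ledger B :=
  [seq inr ((fb : final_block s) i) | fb <- ch].

Definition chop (k : nat) (A : Type) (l : seq A) : seq A :=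
  take (size l - k) l.

Definition sends e r p q (x : payload B (lam X) s) : Prop :=
  (r < R)%N /\ List.In x (sent X e r p q).

Definition joins e p : Prop := p \in corrupt X e /\ honest e.+1 p.

(* [f] bounds the number of corrupted parties and [k] is the number of last
   blocks not yet considered stable.  Nothing is imposed on corrupted parties,
   nor on what a committee outputs when it is not [secure]. *)
Record elastico (f k : nat) : Prop := {
  el_epochs : (0 < E)%N;
  el_rounds : (0 < R)%N;
  el_corrupt : forall e, (#|corrupt X e| <= f)%N;
  el_input_neq0 : input X <> [::];
  el_input_valid : valid_seq (genesis X) (fun=> False) (input X);

  el_pow : forall e p, (e < E)%N ->
    (hash_pow O (seed X e) p (nonce X e p) < difficulty X)%N;
  el_committee : forall e p, (e < E)%N ->
    committee X e p
      = (hash_pow O (seed X e) p (nonce X e p) %% 2 ^ s)%N :> nat;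
  el_committee_size : forall e i, (e < E)%N -> #|members e i| = c;

  el_shard_valid : forall e i p, (e < E)%N -> secure e i ->
    p \in members e i -> honest e p ->
    valid_seq (genesis X) (in_chain (chain X e p)) (decided X e i);
  el_shard_assigned : forall e i t, (e < E)%N -> secure e i ->
    t \in (decided X e i : seq tx) ->
    (hash_ins O (ins t) %% 2 ^ s)%N = i;
  el_shard_verified : forall e i p, (e < E)%N -> secure e i ->
    p \in members e i -> honest e p ->
    {subset (decided X e i : seq tx) <= verified X e p};
  el_shard_bft : forall e r i p q d, (e < E)%N -> honest e p ->
    sends e r p q (ShardBft i d) ->
    p \in members e i /\ q \in members e i;
  el_shard_send : forall e i p q, (e < E)%N -> secure e i ->
    p \in members e i -> honest e p -> q \in members e (final X e) -> q != p ->
    exists r, sends e r p q (ShardBlock i (decided X e i));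

  el_final_bft : forall e r p q d, (e < E)%N -> honest e p ->
    sends e r p q (FinalBft d) ->
    p \in members e (final X e) /\ q \in members e (final X e);
  el_final_broadcast : forall e p q, (e < E)%N -> secure e (final X e) ->
    p \in members e (final X e) -> honest e p -> q != p ->
    sends e R.-1 p q (Final (the_final_block e));

  el_chain0 : forall p, chain X 0 p = [::];
  el_chain_secure : forall e p, (e < E)%N -> honest e p ->
    secure e (final X e) ->
    chain X e.+1 p = rcons (chain X e p) (the_final_block e);
  el_chain_insecure : forall e p, (e < E)%N -> honest e p ->
    ~~ secure e (final X e) ->
    chain X e.+1 p = chain X e p \/
    exists fb q r, [/\ q \in members e (final X e), sends e r q p (Final fb) &
      chain X e.+1 p = rcons (chain X e p) fb];
  el_chain_join : forall e p, (e.+1 < E)%N -> joins e p ->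
    exists q q' r, [/\ honest e q, chain X e.+1 p = chain X e.+1 q &
      sends e.+1 r q' p (Sync (chain X e.+1 q))];

  el_opened : forall e p, (e < E)%N -> secure e (final X e) ->
    p \in opened X e -> p \in members e (final X e);
  el_opened_honest : forall e p, (e < E)%N -> secure e (final X e) ->
    p \in members e (final X e) -> honest e p -> p \in opened X e;
  el_commit_reveal : forall e, (e < E)%N -> secure e (final X e) ->
    exists r0, forall p q, p \in opened X e ->
      q \in members e (final X e) -> honest e q -> q != p ->
      (exists2 r, (r < r0)%N &
         sends e r p q (Commit (commitment O (contribution X e p)))) /\
      (exists2 r, (r0 <= r)%N & sends e r p q (Reveal (contribution X e p)));
  el_seed : forall e, (e < E)%N -> secure e (final X e) ->
    seed X e.+1 = \sum_(p in opened X e) contribution X e p;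

  el_kept : forall p i, honest E.-1 p ->
    (i, headers (chain X E p) i) \in kept X p;
  (* the transactions of T have been given for long enough to be included *)
  el_included : forall p t, honest E.-1 p -> t \in input X ->
    in_chain (chop k (chain X E p)) t
}.
End Elastico.

Section Factors.
Variables (R : realType) (B c s : nat).
(* Storing or sending one header (or any constant-size item) is charged [h]
   transactions. *)
Variables (h : R) (k : nat) (X : execution B c s).

Definition ledger_size (L : stored_ledger B) : R :=
  \sum_(x <- L) (if x is inl b then (size (b : seq tx))%:R else h).

Definition space_factor : R :=
  (\sum_(p : party c s) \sum_(L <- kept X p) ledger_size (chop k L.2))
    / ((c * 2 ^ s)%:R * (size (input X))%:R).

Definition computation_factor : R :=
  (\sum_(p : party c s) \sum_(e < epochs X) (size (verified X e p))%:R)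
    / (size (input X))%:R.

Definition payload_size (x : payload B (lam X) s) : R :=
  match x with
  | ShardBft _ d | FinalBft d => d%:R
  | ShardBlock _ b => h + (size (b : seq tx))%:R
  | Final _ => (2 ^ s)%:R * h
  | Sync ch => (size ch * 2 ^ s)%:R * h
  | Identity _ | Commit _ | Reveal _ => h
  end.

Definition subroutines : seq (pred (payload B (lam X) s)) :=
  [:: fun x => if x is ShardBft _ _ then true else false;
      fun x => if x is ShardBlock _ _ then true else false;
      fun x => if x is FinalBft _ then true else false;
      fun x => if x is Final _ then true else false;
      (* epoch transitions *)
      fun x => if x is Identity _ then true else false;
      fun x => if x is Sync _ then true else false;
      fun x => match x with Commit _ | Reveal _ => true | _ => false end].

Definition traffic (u : pred (payload B (lam X) s)) : R :=
  \sum_(e < epochs X) \sum_(r < rounds X)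
    \sum_(p : party c s) \sum_(q : party c s)
      \sum_(x <- sent X e r p q | u x) payload_size x.

(* Dividing the traffic of the whole execution by the number of transactions
   shares the cost of a transition among the transactions of the epoch. *)
Definition communication_factor : R :=
  \big[Num.max/0]_(u <- subroutines)
    (traffic u / ((c * 2 ^ s)%:R * (size (input X))%:R)).
End Factors.

Local Open Scope classical_set_scope.

(* The number of parties [c * 2 ^ s] tends to infinity with [s], while the
   committee size [c] is constant. *)
Definition scalability (R : realType) (B c : nat) (h : R) (k : nat)
    (X : forall s, execution B c s) : Prop :=
  let n : nat -> R^o := fun s => (c * 2 ^ s)%:R in
  [/\ (fun s => communication_factor h (X s) : R^o) =o_\oo n,
      (fun s => space_factor h k (X s) : R^o) =o_\oo (fun=> 1 : R^o) &
      (fun s => computation_factor R (X s) : R^o) =o_\oo n].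

(* Main.v *)
Require Import Defs.
From mathcomp Require Import all_boot all_order all_algebra.
From mathcomp Require Import all_classical all_reals all_analysis.
From mathcomp Require Import zify ring.
Import Order.TTheory GRing.Theory Num.Theory.
Import numFieldNormedType.Exports.
Set Implicit Arguments.
Unset Strict Implicit.
Unset Printing Implicit Defensive.
Local Open Scope ring_scope.

(* The final block of an epoch holds one header per shard, and a shard's block
   holds at most [B] transactions.  A party storing all final blocks that cover
   [T] therefore stores at least [|T| / B] headers.  More than three quarters of
   the parties are honest and do so, hence the space factor is bounded away
   from 0. *)

(** * An execution without corruption, witnessing that the model is satisfiable *)

Section HonestExecution.
Variables (c B k s : nat).
Hypotheses (c_gt0 : (0 < c)%N) (B_gt0 : (0 < B)%N).

Lemma shards_gt0 : (0 < 2 ^ s)%N.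
Proof. by rewrite expn_gt0. Qed.

Definition shard0 : shard s := Ordinal shards_gt0.

Definition residue_shard (p : party c s) : shard s :=
  Ordinal (ltn_pmod p shards_gt0).

(** The class of [i] modulo [2 ^ s] consists of the numbers [j * 2 ^ s + i] with [j < c]. *)
Lemma card_residue_shard (i : shard s) :
  #|[set p : party c s | residue_shard p == i]| = c.
Proof.
have lt_pos (j : 'I_c) : (j * 2 ^ s + i < c * 2 ^ s)%N.
  apply: (@leq_trans (j.+1 * 2 ^ s)); last by rewrite leq_mul2r ltn_ord orbT.
  by rewrite mulSn addnC ltn_add2r.
pose pos j : party c s := Ordinal (lt_pos j).
have pos_inj : injective pos.
  move=> j1 j2 [/eqP].
  by rewrite eqn_add2r eqn_pmul2r ?shards_gt0 // => /eqP /val_inj.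
rewrite -[RHS]card_ord -(card_imset predT pos_inj); apply: eq_card => p.
rewrite inE; apply/eqP/imsetP => [res_p | [j _ ->]]; last first.
  by apply: val_inj; rewrite /= modnMDl modn_small.
have lt_quo : (p %/ 2 ^ s < c)%N by rewrite ltn_divLR ?shards_gt0.
exists (Ordinal lt_quo) => //; apply: val_inj.
by rewrite /= -res_p /= -divn_eq.
Qed.

Definition coin_transfer : tx := ([:: 0%N], [:: 1%N]).

Definition transfer_block : block B :=
  Bseq (B_gt0 : (size [:: coin_transfer] <= B)%N).

Definition empty_block : block B :=
  Bseq (leq0n B : (size (@nil tx) <= B)%N).

Definition transfer_decided (e : nat) (i : shard s) : block B :=
  if (e == 0%N) && (i == shard0) then transfer_block else empty_block.

(** [pickle] is injective, hence ideally binding. The proof-of-work hash ignores seed and nonce, so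
    that it yields the residue committees and always stays below the difficulty [2 ^ s]. *)
Definition residue_oracles : oracles B s := {|
  merkle := pickle;
  merkle_inj := pcan_inj pickleK;
  commitment := pickle;
  commitment_inj := pcan_inj pickleK;
  hash_ins := fun=> 0%N;
  hash_pow := fun _ p _ => (p %% 2 ^ s)%N |}.

Definition transfer_final_block (e : nat) : final_block s :=
  [ffun i => merkle residue_oracles (transfer_decided e i)].

Definition honest_sent (e r : nat) (p q : party c s) : seq (payload B s s) :=
  if r == 0%N then
    [:: ShardBlock (residue_shard p) (transfer_decided e (residue_shard p));
        Commit (commitment residue_oracles 0)]
  else [:: Reveal 0; Final (transfer_final_block e)].

(* The transfer is included in epoch 0; the [k] later epochs, with empty blocks,
   make its block stable. *)
Definition honest_execution : execution B c s := {|
  epochs := k.+1;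
  rounds := 2;
  oracle := residue_oracles;
  difficulty := 2 ^ s;
  genesis := [:: 0%N];
  input := [:: coin_transfer];
  corrupt := fun=> finset.set0;
  seed := fun=> 0;
  nonce := fun _ _ => 0%N;
  committee := fun=> residue_shard;
  final := fun=> shard0;
  decided := transfer_decided;
  contribution := fun _ _ => 0;
  opened := fun=> [set p | residue_shard p == shard0];
  chain := fun e _ => mkseq transfer_final_block e;
  sent := honest_sent;
  verified := fun e p => transfer_decided e (residue_shard p);
  kept := fun=> [seq (i, headers B (mkseq transfer_final_block k.+1) i)
                  | i <- enum 'I_(2 ^ s)] |}.

Lemma coin_transfer_valid (L : tx -> Prop) :
  (forall t, ~ L t) -> valid_seq [:: 0%N] L [:: coin_transfer].
Proof.
move=> L0; split=> //; split=> // u; rewrite inE => /eqP ->.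
  by split=> [|[t /L0]] //; left.
by case=> [|[t /L0]].
Qed.

Lemma elastico_honest_execution (f : nat) : elastico honest_execution f k.
Proof.
have secureT e i : secure honest_execution e i.
  by rewrite /secure /= finset.setI0 cards0 muln0.
split=> //.
- by move=> e; rewrite cards0.
- by apply: coin_transfer_valid => t.
- by move=> e p _; rewrite ltn_pmod ?shards_gt0.
- by move=> e p _; rewrite modn_mod.
- by move=> e i _; apply: card_residue_shard.
(* A nonempty block occurs only in epoch 0, where the chain is empty and the genesis output still
   unspent. *)
- move=> e i p _ _ _ _; rewrite /= /transfer_decided.
  case: ifP => // /andP[/eqP -> _].
  by apply: coin_transfer_valid => t [fb [j [b []]]].
- move=> e i t _ _; rewrite /= /transfer_decided.
  by case: ifP => // /andP[_ /eqP ->] _; rewrite /= mod0n.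
- by move=> e i p _ _; rewrite inE => /eqP /= <- _ t.
- by move=> e [|r] i p q d _ _ [_] /= [|[|]].
- move=> e i p q _ _; rewrite inE => /eqP /= <- _ _ _.
  by exists 0%N; split=> //; left.
- by move=> e [|r] p q d _ _ [_] /= [|[|]].
- by move=> e p q _ _ _ _ _; split=> //=; right; left.
- by move=> e p _ _ _; apply: mkseqS.
- by move=> e p _ _; rewrite secureT.
- by move=> e p _ []; rewrite inE.
- move=> e _ _; exists 1%N => p q _ _ _ _; split.
    by exists 0%N => //; split=> //=; right; left.
  by exists 1%N => //; split=> //=; left.
- by move=> e _ _; rewrite big1.
- by move=> p i _; apply/mapP; exists i; rewrite ?mem_enum.
- move=> p t _; rewrite inE => /eqP ->.
  (* Chopping [k] of the [k.+1] final blocks leaves exactly that of epoch 0. *)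
  exists (transfer_final_block 0), shard0, transfer_block; split.
  + by rewrite /chop /= size_map size_iota subSnn /= mem_head.
  + by rewrite ffunE /transfer_decided !eqxx.
  + by rewrite inE.
Qed.

End HonestExecution.

(** * Counting the distinct transactions of a chain of final blocks *)

(** A valid transaction has at least one input, which is spent as soon as the transaction is in the
    ledger; repeating it would be a double spend. *)
Lemma valid_seq_notin (g : seq utxo) (L : tx -> Prop) (ts : seq tx) (t : tx) :
  valid_seq g L ts -> L t -> t \notin ts.
Proof.
elim: ts L => //= t' ts IHts L [[ins_neq0 _ _ fresh _] valid_ts] Lt.
rewrite inE negb_or (IHts _ valid_ts) ?andbT; last by left.
apply/eqP => eq_tt'.
case def_ins: (ins t') ins_neq0 => [//|u us] _.
have u_in : u \in ins t' by rewrite def_ins mem_head.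
by have [_ []] := fresh u u_in; exists t; rewrite // eq_tt'.
Qed.

Lemma valid_seq_uniq (g : seq utxo) (L : tx -> Prop) (ts : seq tx) :
  valid_seq g L ts -> uniq ts.
Proof.
elim: ts L => //= t ts IHts L [_ valid_ts].
by rewrite (IHts _ valid_ts) (valid_seq_notin valid_ts) //; right.
Qed.

(* Merkle roots determine their blocks, so a chain of [l] final blocks commits
   to at most [l * 2 ^ s] blocks. *)
Lemma in_chain_size (B c s : nat) (X : execution B c s)
    (ch : seq (final_block s)) (ts : seq tx) :
  uniq ts -> (forall t, t \in ts -> in_chain X ch t) ->
  (size ts <= size ch * 2 ^ s * B)%N.
Proof.
move=> ts_uniq ts_in.
(* Injectivity of [merkle] leaves at most one block per digest; a digest that is no root gets the
   empty block, and the condition is then vacuous. *)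
have /choice[preim preimP] : forall d : digest, exists b' : block B,
    forall b, merkle (oracle X) b = d -> b = b'.
  move=> d; have [[b def_d]|no_b] := pselect (exists b, merkle (oracle X) b = d).
    by exists b => b'; rewrite -def_d => /merkle_inj.
  by exists (empty_block B) => b def_d; case: no_b; exists b.
pose roots := [seq (fb : final_block s) i | fb <- ch, i <- enum 'I_(2 ^ s)].
have -> : (size ch * 2 ^ s)%N = size roots by rewrite size_allpairs size_enum_ord.
have sub : {subset ts <= flatten [seq preim d : seq tx | d <- roots]}.
  move=> t /ts_in[fb [i [b [fb_in def_b t_in]]]].
  apply/flatten_mapP; exists (fb i); last by rewrite -(preimP _ _ (esym def_b)).
  by apply/allpairsP; exists (fb, i); rewrite mem_enum.
apply: leq_trans (uniq_leq_size ts_uniq sub) _.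
elim: roots {sub} => //= d ds IHds.
by rewrite size_cat mulSn leq_add // size_bseq.
Qed.

(** * Lower bounds on storage *)

(** Each element of [s1] uses up one occurrence in [s2], and the leftover terms are nonnegative.
    This allows parties to keep further ledgers besides the header ledgers. *)
Lemma ler_sum_subset (R : numDomainType) (T : eqType) (s1 s2 : seq T)
    (F : T -> R) :
  uniq s1 -> {subset s1 <= s2} -> (forall x, 0 <= F x) ->
  \sum_(x <- s1) F x <= \sum_(x <- s2) F x.
Proof.
move=> + + F_ge0; elim: s1 s2 => [|x s1 IHs1] s2 /=.
  by rewrite big_nil sumr_ge0.
case/andP=> x_notin s1_uniq sub.
have /perm_to_rem s2_perm : x \in s2 by rewrite sub ?mem_head.
rewrite (perm_big _ s2_perm) !big_cons lerD2l; apply: IHs1 => // y y_in.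
have : y \in s2 by rewrite sub // inE y_in orbT.
rewrite (perm_mem s2_perm) inE => /orP[/eqP eq_yx|//].
by rewrite eq_yx (negPf x_notin) in y_in.
Qed.

Lemma ledger_size_ge0 (R : realType) (B : nat) (h : R) (L : stored_ledger B) :
  0 <= h -> 0 <= ledger_size h L.
Proof. by move=> h_ge0; apply: sumr_ge0 => -[b|d] _. Qed.

Lemma ledger_size_headers (R : realType) (B s k : nat) (h : R)
    (ch : seq (final_block s)) (i : shard s) :
  ledger_size h (chop k (headers B ch i)) = h *+ size (chop k ch).
Proof.
rewrite /ledger_size /chop size_map -map_take big_map big_const_seq count_predT.
exact: iter_addr_0.
Qed.

Lemma kept_size_ge (R : realType) (B c s f k : nat) (h : R)
    (X : execution B c s) (p : party c s) :
  (0 < B)%N -> 0 < h -> elastico X f k -> honest X (epochs X).-1 p ->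
  h * (size (input X))%:R / B%:R
    <= \sum_(L <- kept X p) ledger_size h (chop k L.2).
Proof.
move=> B_gt0 h_gt0 elX p_honest; set ch := chain X (epochs X) p.
have input_le : (size (input X) <= size (chop k ch) * 2 ^ s * B)%N.
  apply: (in_chain_size (X := X)).
    exact: valid_seq_uniq (el_input_valid elX).
  by move=> t; apply: (el_included elX).
pose hdrs := [seq (i, headers B ch i) | i <- enum 'I_(2 ^ s)].
(* The shard labels keep the entries distinct even when two header ledgers coincide. *)
have hdrs_uniq : uniq hdrs by rewrite map_inj_uniq ?enum_uniq // => i j [].
have hdrs_kept : {subset hdrs <= kept X p}.
  by move=> _ /mapP[i _ ->]; apply: (el_kept elX).
apply: le_trans (ler_sum_subset hdrs_uniq hdrs_kept _); last first.
  by move=> L; apply/ledger_size_ge0/ltW.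
rewrite big_map (eq_bigr (fun=> h *+ size (chop k ch))); last first.
  by move=> i _; rewrite ledger_size_headers.
rewrite big_const_seq count_predT size_enum_ord iter_addr_0 -mulrnA.
rewrite ler_pdivrMr ?ltr0n // -[h *+ _]mulr_natr -mulrA -natrM.
by rewrite ler_pM2l // ler_nat.
Qed.

(** Storage is measured after the last epoch, so honesty in that epoch is what counts. Bounding the
    honest fraction below by one half gives the factor 2. *)
Lemma space_factor_ge (R : realType) (B c s f k : nat) (h : R)
    (X : execution B c s) :
  (0 < B)%N -> 0 < h -> (4 * f < c * 2 ^ s)%N -> elastico X f k ->
  h / (2 * B%:R) <= space_factor h k X.
Proof.
move=> B_gt0 h_gt0 f_lt elX; rewrite /space_factor.
have T_gt0 : (0 < size (input X))%N.
  by case: (input X) (el_input_neq0 elX).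
have n_gt0 : (0 < c * 2 ^ s)%N by apply: leq_ltn_trans f_lt.
set P := finset.setC (corrupt X (epochs X).-1).
have P_ge : (c * 2 ^ s <= 2 * #|P|)%N.
  have := finset.cardsC (corrupt X (epochs X).-1).
  rewrite -/P card_ord; have := el_corrupt elX (epochs X).-1; lia.
rewrite ler_pdivlMr -?natrM ?ltr0n; last by rewrite muln_gt0 n_gt0.
apply: (@le_trans _ _ (\sum_(p in P) h * (size (input X))%:R / B%:R)).
  rewrite sumr_const -[leRHS]mulr_natr.
  have -> : h / (2 * B)%:R * (c * 2 ^ s * size (input X))%:R
          = h * (size (input X))%:R / B%:R * ((c * 2 ^ s)%:R / 2).
    by rewrite !natrM; field; rewrite pnatr_eq0 -lt0n.
  apply: ler_wpM2l; first by rewrite !mulr_ge0 ?invr_ge0 ?ler0n ?ltW.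
  by rewrite ler_pdivrMr // -natrM ler_nat [leqRHS]mulnC.
(* Corrupted parties may store nothing: their share is only bounded below by 0. *)
rewrite [leRHS](bigID (mem P)) /= -[leLHS]addr0; apply: lerD.
  by apply: ler_sum => p; rewrite finset.inE => p_honest; apply: kept_size_ge elX _.
by apply: sumr_ge0 => p _; apply: sumr_ge0 => L _; apply/ledger_size_ge0/ltW.
Qed.

(* Whatever the adversary and the random choices do, an execution family of
   Elastico does not scale; such families exist. *)
Theorem theorem27 (R : realType) (c B k : nat) (h : R) (f : nat -> nat)
    (hc : (0 < c)%N) (hB : (0 < B)%N) (hh : 0 < h)
    (hf : forall s, (4 * f s < c * 2 ^ s)%N) :
  (exists X : forall s, execution B c s, forall s, elastico (X s) (f s) k) /\
  (forall X : forall s, execution B c s,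
     (forall s, elastico (X s) (f s) k) -> ~ scalability h k X).
Proof.
split=> [|X elX [_ /eqoP space_o1 _]].
  exists (fun s => honest_execution c k s hB) => s.
  exact: elastico_honest_execution.
(* This is half of the lower bound on the space factor. That bound is uniform in [s], so one [s] at
   the little-o threshold already gives a contradiction. *)
have eps_gt0 : 0 < h / (4 * B%:R) by rewrite divr_gt0 ?mulr_gt0 ?ltr0n.
have [s _ /(_ s (leqnn s))] := space_o1 _ eps_gt0.
rewrite /= normr1 mulr1 => /(le_trans (ler_norm _)).
apply/negP; rewrite -ltNge; apply: lt_le_trans (space_factor_ge hB hh (hf s) (elX s)).
by rewrite ltr_pM2l // ltf_pV2 ?posrE ?mulr_gt0 ?ltr0n // ltr_pM2r ?ltr0n // ltr_nat.
Qed.
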